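(* Let $p$ be a prime, $k\ge 1$ and $n=p^k$. Let $k^*$ denote the largest proper factor of $k$. Then the Hamming distance of the group $A\Gamma L(1,n)$, acting on $\mathbb{F}_n$, is $n-p^{k^*}$.
   Context: A proper factor of $k$ is a positive divisor of $k$ smaller than $k$; for $k=1$ take $k^*=0$. $\mathbb{F}_n$ is the finite field with $n$ elements. $A\Gamma L(1,n)=\{x\mapsto ax^{p^i}+b \mid a,b\in\mathbb{F}_n,\ a\neq 0,\ 0\le i<k\}$, a group of $kn(n-1)$ permutations of $\mathbb{F}_n$ under composition. For permutations $\pi,\sigma$ of a set, $hd(\pi,\sigma)$ is the number of points $x$ with $\pi(x)\ne\sigma(x)$; the Hamming distance of a set of permutations is the minimum of $hd$ over pairs of distinct elements.
   Formalization: The case n = 2 (p = 2, k = 1) is excluded, because there the group is {x, x+1}, whose Hamming distance is 2 while the formula n − p^{k*} gives 1. *)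

(* Defs.v *)
From mathcomp Require Import all_boot all_order all_fingroup all_algebra.

Set Implicit Arguments.
Unset Strict Implicit.
Unset Printing Implicit Defensive.

(* For k = 1 the range is empty (0 does not divide 1), which gives the
   convention 1^* = 0. *)
Definition largest_proper_factor (k : nat) : nat := \max_(d < k | d %| k) d.

Definition hd (T : finType) (s t : {perm T}) : nat := #|[set x | s x != t x]|.

(* The default value #|T| bounds every hd s t, so it affects the minimum only
   when A has no two distinct elements. *)
Definition hamming_distance (T : finType) (A : {set {perm T}}) : nat :=
  \big[minn/#|T|]_(st : {perm T} * {perm T}
                   | [&& st.1 \in A, st.2 \in A & st.1 != st.2]) hd st.1 st.2.

(* When #|F| = p ^ k with p prime, every map x |-> a x^(p^i) + b with a != 0 is
   bijective, so restricting to {perm F} discards none of them. *)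
Definition AGammaL1 (p k : nat) (F : finFieldType) : {set {perm F}} :=
  [set s : {perm F} | [exists a : F, exists b : F, exists i : 'I_k,
     (a != 0%R) && [forall x : F, s x == (a * x ^+ (p ^ i)%N + b)%R]]].

(* Main.v *)
(* The points where a x^(p^i) + b and c x^(p^j) + d agree, i <= j, are at most
   one or inject affinely into the fixed points of x |-> x^(p^(j-i)), which form
   the subfield of order p^gcd(j-i,k).  For 0 < j - i < k the gcd is a proper
   factor of k, which bounds the agreement by p^(k^* ).  For k > 1 the bound is
   attained by the identity and x |-> x^(p^(k^* )); for k = 1 by the identity
   and x |-> c x with c different from 0 and 1. *)

Require Import Defs.
From mathcomp Require Import all_boot all_order all_fingroup all_algebra.
From mathcomp Require Import cyclic finfield.

Set Implicit Arguments.
Unset Strict Implicit.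
Unset Printing Implicit Defensive.

Import GRing.Theory.

Lemma leq_largest_proper_factor k d :
  d < k -> d %| k -> d <= largest_proper_factor k.
Proof. by move=> d_lt; apply: (leq_bigmax_cond (Ordinal d_lt)). Qed.

Lemma largest_proper_factorP k : 1 < k ->
  [/\ 0 < largest_proper_factor k, largest_proper_factor k < k
    & largest_proper_factor k %| k].
Proof.
move=> k_gt1; pose A := [pred d : 'I_k | d %| k].
have A_gt0 : 0 < #|A| by apply/card_gt0P; exists (Ordinal k_gt1); apply: dvd1n.
have [d d_dvd lpf_d] := eq_bigmax_cond (@nat_of_ord k) A_gt0.
split; first by rewrite leq_largest_proper_factor ?dvd1n.
  by rewrite [largest_proper_factor k]lpf_d.
by rewrite [largest_proper_factor k]lpf_d.
Qed.

Section Frobenius.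

Local Open Scope ring_scope.

Variables (p k : nat) (F : finFieldType).
Hypotheses (p_prime : prime p) (k_gt0 : (0 < k)%N) (card_F : #|F| = (p ^ k)%N).

Lemma expr_pXnB i (x y : F) : (x - y) ^+ (p ^ i) = x ^+ (p ^ i) - y ^+ (p ^ i).
Proof.
have chi : [pchar F].-nat (p ^ i)%N.
  by rewrite pnatX pnatE // (card_finPcharP card_F p_prime).
by rewrite exprDn_pchar // exprNn_pchar.
Qed.

Lemma expr_pXn_inj i : injective (fun x : F => x ^+ (p ^ i)).
Proof.
move=> x y /eqP; rewrite -subr_eq0 -expr_pXnB expf_eq0 => /andP[_].
by rewrite subr_eq0 => /eqP.
Qed.

Lemma fix_pXn_iter m (x : F) u : x ^+ (p ^ m) = x -> x ^+ (p ^ (u * m)) = x.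
Proof.
move=> xm; elim: u => [|u IHu]; first by rewrite mul0n expn0 expr1.
by rewrite mulSn expnD exprM xm.
Qed.

(** Every point of [F] is fixed by the [p ^ k]-th power, so Bezout turns a fixed point of the
    [p ^ m]-th power into one of the [p ^ g]-th power, [g = gcdn m k]: a root of ['X^(p ^ g) - 'X],
    whose degree is [p ^ g]. *)
Lemma card_fix_pXn_le m : (0 < m)%N ->
  (#|[set x : F | x ^+ (p ^ m) == x]| <= p ^ gcdn m k)%N.
Proof.
move=> m_gt0; set g := gcdn m k.
have g_gt0 : (0 < g)%N by rewrite gcdn_gt0 m_gt0.
have q_gt1 : (1 < p ^ g)%N by rewrite -(exp1n g) ltn_exp2r // prime_gt1.
set P : {poly F} := 'X^(p ^ g) - 'X.
have szP : size P = (p ^ g).+1.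
  by rewrite size_polyDl ?size_polyXn // size_polyN size_polyX ltnS.
have P_neq0 : P != 0 by rewrite -size_poly_eq0 szP.
rewrite -ltnS -szP cardE; apply: max_poly_roots => //; last exact: enum_uniq.
apply/allP => x; rewrite mem_enum inE => /eqP xm.
rewrite rootE !hornerE subr_eq0.
have xk : x ^+ (p ^ k) = x by rewrite -card_F expf_card.
(* Here [u * m = v * k + g]: the powers with exponents [p ^ (u * m)] and [p ^ (v * k)] both fix [x],
   which leaves the exponent [p ^ g]. *)
case: (egcdnP k m_gt0) => u v uv _.
rewrite -{2}(fix_pXn_iter u xm) uv expnD exprM.
by rewrite fix_pXn_iter.
Qed.

(** The unit group of [F] is cyclic, and [p ^ d - 1] divides its order. The powers of an element [z]
    of order [p ^ d - 1], together with 0, are [p ^ d] distinct fixed points. *)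
Lemma card_fix_pXn_ge d : (0 < d)%N -> (d %| k)%N ->
  (p ^ d <= #|[set x : F | x ^+ (p ^ d) == x]|)%N.
Proof.
move=> d_gt0 d_dvd.
have q_gt1 : (1 < p ^ d)%N by rewrite -(exp1n d) ltn_exp2r // prime_gt1.
have q1_gt0 : (0 < (p ^ d).-1)%N by rewrite -ltnS prednK // ltnW.
(* With [q = p ^ d], the order of [F] is a power of [q], and [q - 1] divides [q ^ e - 1] for every
   [e]. *)
have dvd_q : ((p ^ d).-1 %| #|F|.-1)%N.
  by rewrite card_F -(divnK d_dvd) mulnC expnM dvdn_pred_predX.
have F_gt1 : (1 < #|F|)%N.
  by rewrite card_F -(exp1n k) ltn_exp2r // prime_gt1.
have [z z_prim] : exists z : F, (p ^ d).-1.-primitive_root z.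
  have /hasP[w _ w_prim] : has #|F|.-1.-primitive_root (enum (predC1 (0 : F))).
    apply: has_prim_root; rewrite ?enum_uniq -?cardE ?cardC1 //.
      by rewrite -ltnS prednK // ltnW.
    apply/allP => x; rewrite mem_enum inE /= => x_neq0.
    rewrite unity_rootE -(inj_eq (mulfI x_neq0)) -exprS prednK ?expf_card ?mulr1 //.
    exact: ltnW.
  by exists (w ^+ (#|F|.-1 %/ (p ^ d).-1)); apply: dvdn_prim_root.
have z_neq0 : z != 0.
  have /eqP := prim_expr_order z_prim; apply: contraTneq => ->.
  by rewrite expr0n gtn_eqF // eq_sym oner_eq0.
pose f (i : 'I_(p ^ d).-1) := z ^+ i.
have f_inj : injective f.
  move=> i j /eqP; rewrite (eq_prim_root_expr z_prim) !modn_small //.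
  by move/eqP/val_inj.
have f_notin0 : 0 \notin [set f i | i : 'I_(p ^ d).-1].
  by apply/imsetP => -[i _ /esym/eqP]; rewrite expf_eq0 (negPf z_neq0) andbF.
have card_U : #|0 |: [set f i | i : 'I_(p ^ d).-1]| = (p ^ d)%N.
  by rewrite cardsU1 f_notin0 card_imset // card_ord add1n prednK // ltnW.
rewrite -[leqLHS]card_U.
apply/subset_leq_card/subsetP => x; rewrite !inE => /predU1P[->|/imsetP[i _ ->]].
  by rewrite expf_eq0 eqxx expn_gt0 prime_gt0.
have zq : z ^+ (p ^ d) = z.
  by rewrite -(prednK (ltnW q_gt1)) exprS (prim_expr_order z_prim) mulr1.
by rewrite /f -exprM mulnC exprM zq.
Qed.

(* Two points of agreement x0, x1 normalise all the others: for every further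
   one x, the ratio (x - x0) / (x1 - x0) is fixed by the (p^(j-i))-th power. *)
Lemma card_agree_le (a b c d : F) (i j : nat) :
    a != 0 -> c != 0 -> (i < k)%N -> (j < k)%N ->
    ~ [/\ a = c, b = d & i = j] ->
  (#|[set x : F | (a * x ^+ (p ^ i) + b == c * x ^+ (p ^ j) + d)%R]|
     <= p ^ largest_proper_factor k)%N.
Proof.
wlog le_ij : a b c d i j / (i <= j)%N.
  move=> IH a_neq0 c_neq0 ik jk neq; case: (leqP i j) => [|/ltnW] le.
    exact: IH.
  under eq_finset => x do rewrite eq_sym.
  by apply: IH => // -[? ? ?]; apply: neq; split.
move=> a_neq0 c_neq0 _ jk neq; set A := [set x | _].
(* Subtracting two agreement equations eliminates [b] and [d], since the powers involved are
   additive. *)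
have agreeB x y : x \in A -> y \in A ->
    a * (x - y) ^+ (p ^ i) = c * (x - y) ^+ (p ^ j).
  rewrite !inE !expr_pXnB !mulrBr => /eqP xA /eqP yA.
  have subDr (u v w : F) : (u + w) - (v + w) = u - v.
    by rewrite opprD addrACA subrr addr0.
  by rewrite -(subDr _ _ b) xA yA subDr.
have [A_le1|/card_gt1P[x1 [x0 [x1A x0A x10]]]] := leqP #|A| 1.
  by apply: leq_trans A_le1 _; rewrite expn_gt0 prime_gt0.
have y1_neq0 : x1 - x0 != 0 by rewrite subr_eq0.
have y1q_neq0 l : (x1 - x0) ^+ (p ^ l) != 0 by rewrite expf_neq0.
(* With equal exponents, two points of agreement force [a = c] and then [b = d], against the
   distinctness of the maps. *)
have lt_ij : (i < j)%N.
  rewrite ltn_neqAle le_ij andbT; apply/eqP => eq_ij.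
  have := agreeB _ _ x1A x0A; rewrite -eq_ij => /(mulIf (y1q_neq0 i)) eq_ac.
  move: x0A; rewrite inE -eq_ij eq_ac => /eqP/addrI eq_bd.
  exact: neq.
have m_gt0 : (0 < j - i)%N by rewrite subn_gt0.
have g_le : (gcdn (j - i) k <= largest_proper_factor k)%N.
  apply: leq_largest_proper_factor; last exact: dvdn_gcdr.
  apply: leq_ltn_trans (dvdn_leq m_gt0 (dvdn_gcdl _ _)) _.
  exact: leq_ltn_trans (leq_subr _ _) jk.
apply: leq_trans (leq_pexp2l (prime_gt0 p_prime) g_le).
apply: leq_trans (card_fix_pXn_le m_gt0).
have f_inj : injective (fun x => (x - x0) / (x1 - x0)).
  by move=> x y /(mulIf (invr_neq0 y1_neq0))/addIr.
rewrite -(card_imset A f_inj); apply/subset_leq_card/subsetP => _ /imsetP[x xA ->].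
(* After raising to the injective [p ^ i]-th power, it remains to equate the [p ^ j]-th and
   [p ^ i]-th powers of the ratio. This is the quotient of [agreeB] at [x, x0] by [agreeB] at
   [x1, x0]. *)
rewrite inE; apply/eqP/(@expr_pXn_inj i); rewrite -exprM -expnD subnK ?(ltnW lt_ij) //.
rewrite !expr_div_n.
apply: (canLR (mulfK (y1q_neq0 j))); apply: (mulfI c_neq0).
by rewrite -agreeB // mulrCA -agreeB // mulrCA divfK.
Qed.

End Frobenius.

Lemma leq_bigminn (I : finType) (P : pred I) (E : I -> nat) (m d : nat) :
  m <= d -> (forall i, P i -> m <= E i) -> m <= \big[minn/d]_(i | P i) E i.
Proof.
move=> md mE; apply: (big_ind (fun x => m <= x)) => // x y mx my.
by rewrite leq_min mx.
Qed.

Lemma bigminn_leq (I : finType) (P : pred I) (E : I -> nat) (j : I) (d : nat) :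
  P j -> \big[minn/d]_(i | P i) E i <= E j.
Proof.
move=> Pj; rewrite -minEnat -leEnat.
exact: (Order.TotalTheory.bigmin_le_cond d E Pj).
Qed.

Lemma hd_agree (T : finType) (s t : {perm T}) :
  hd s t = #|T| - #|[set x | s x == t x]|.
Proof.
by rewrite /hd cardsCs; congr (_ - #|pred_of_set _|); apply/setP => x; rewrite !inE negbK.
Qed.

Lemma AGammaL1P (p k : nat) (F : finFieldType) (s : {perm F}) :
  reflect (exists a b : F, exists2 i, i < k &
             a != 0%R /\ forall x, s x = (a * x ^+ (p ^ i)%N + b)%R)
          (s \in AGammaL1 p k F).
Proof.
rewrite inE; apply: (iffP existsP) => [[a /existsP[b /existsP[i /andP[a0 /forallP s_def]]]]|].
  by exists a, b, i => //; split=> // x; apply/eqP.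
move=> [a [b [i ik [a0 s_def]]]]; exists a; apply/existsP; exists b.
apply/existsP; exists (Ordinal ik); rewrite a0; apply/forallP => x.
exact/eqP.
Qed.

Theorem theorem1 (p k n : nat) (F : finFieldType)
  (p_prime : prime p) (k_ge1 : 1 <= k) (n_def : n = p ^ k)
  (n_neq2 : n <> 2) (* for n = 2 the group is {x, x + 1}, of distance 2 *)
  (card_F : #|F| = n) :
  hamming_distance (AGammaL1 p k F) = n - p ^ largest_proper_factor k.
Proof.
have cardF : #|F| = p ^ k by rewrite card_F.
apply/eqP; rewrite eqn_leq; apply/andP; split; last first.
  (* The lower bound must also hold for the default value [#|F|] of the minimum. *)
  apply: leq_bigminn => [|[s t] /= /and3P[sG tG st]].
    by rewrite card_F leq_subr.
  case/AGammaL1P: sG => a [b [i ik [a0 s_def]]].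
  case/AGammaL1P: tG => c [d [j jk [c0 t_def]]].
  rewrite hd_agree card_F leq_sub2l //.
  under eq_finset => x do rewrite s_def t_def.
  apply: card_agree_le => // -[ac bd ij]; case/eqP: st.
  by apply/permP => x; rewrite s_def t_def ac bd ij.
(* The points where [s] agrees with the identity are its fixed points, so one non-identity element
   with enough of them gives the upper bound. *)
suff [s [sG s_neq1 s_fix]] : exists s : {perm F}, [/\ s \in AGammaL1 p k F,
    s != 1%g & p ^ largest_proper_factor k <= #|[set x | s x == x]|].
  have G1 : 1%g \in AGammaL1 p k F.
    apply/AGammaL1P; exists 1%R, 0%R, 0 => //; split; first exact: oner_neq0.
    by move=> x; rewrite perm1 expn0 expr1 mul1r addr0.
  apply: leq_trans (bigminn_leq (j := (s, 1%g)) _ _ _) _; first exact/and3P.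
  rewrite hd_agree card_F leq_sub2l //.
  by under eq_finset => x do rewrite perm1.
have [k_gt1|k_le1] := ltnP 1 k.
  have [d_gt0 d_lt d_dvd] := largest_proper_factorP k_gt1.
  set d := largest_proper_factor k in d_gt0 d_lt d_dvd *.
  exists (perm (@expr_pXn_inj p k F p_prime cardF d)); split.
  - apply/AGammaL1P; exists 1%R, 0%R, d => //; split; first exact: oner_neq0.
    by move=> x; rewrite permE mul1r addr0.
  - apply/eqP => /permP fix_all.
    (* Were this power map the identity, it would fix [p ^ k] points, but it fixes at most
       [p ^ gcdn d k = p ^ d], and [d < k]. *)
    have := card_fix_pXn_le p_prime cardF d_gt0.
    rewrite (_ : [set x | _] = setT); last first.
      by apply/setP => x; have := fix_all x; rewrite !inE permE perm1 => ->; apply: eqxx.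
    rewrite cardsT cardF leq_exp2l ?prime_gt1 // (gcdn_idPl d_dvd).
    by rewrite leqNgt d_lt.
  under eq_finset => x do rewrite permE.
  exact: (card_fix_pXn_ge p_prime k_ge1 cardF d_gt0 d_dvd).
have k1 : k = 1 by apply/eqP; rewrite eqn_leq k_le1.
have lpf1 : largest_proper_factor k = 0.
  by rewrite /largest_proper_factor k1 big_mkcond big_ord_recl big_ord0.
(* For [k = 1] a single fixed point suffices, and 0 is fixed by every scaling. As [n] exceeds 2,
   there are two distinct nonzero elements, and at least one of them differs from 1. *)
have /card_gt1P[a [b [aU bU ab]]] : 1 < #|predC1 (0%R : F)|.
  have n_gt1 : 1 < n by rewrite n_def k1 expn1 prime_gt1.
  rewrite cardC1 card_F -ltnS prednK ?(ltnW n_gt1) // ltn_neqAle n_gt1 andbT.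
  by rewrite eq_sym; apply/eqP.
have [c c0 c1] : exists2 c : F, c != 0%R & c != 1%R.
  have [a1|a1] := eqVneq a 1%R; last by exists a.
  by exists b => //; rewrite -a1 eq_sym.
exists (perm (mulfI c0)); split.
- apply/AGammaL1P; exists c, 0%R, 0 => //; split=> // x.
  by rewrite permE expn0 expr1 addr0.
- by apply/eqP => /permP/(_ 1%R)/eqP; rewrite permE perm1 mulr1 (negPf c1).
rewrite lpf1 expn0 card_gt0; apply/set0Pn; exists 0%R.
by rewrite inE permE mulr0.
Qed.
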